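(* Let $(Q,+)$ be an abelian group, let $\varphi,\psi$ be automorphisms of $(Q,+)$, let $b\in Q$, and let $(Q,\cdot)$ be the T-quasigroup defined by $x\cdot y=\varphi x+\psi y+b$ for all $x,y\in Q$. Then $(Q,\cdot)$ satisfies the $T_2$-identity $x\cdot(y\cdot(y\cdot x))=y$ (for all $x,y\in Q$) if and only if the following three conditions all hold: $\varphi=I\psi^3$; $\psi^5+\psi^4+1=0$ in the endomorphism ring of $(Q,+)$; and $\psi^2 b+\psi b+b=0$ in $Q$.
   Context: A quasigroup $(Q,\cdot)$ is a set with a binary operation such that for all $a,c\in Q$ each of the equations $a\cdot x=c$ and $y\cdot a=c$ has a unique solution. A T-quasigroup is a quasigroup $(Q,\cdot)$ of the form $x\cdot y=\varphi x+\psi y+b$, where $(Q,+)$ is an abelian group, $\varphi,\psi$ are automorphisms of $(Q,+)$ and $b\in Q$ is a fixed element. $I$ denotes the inversion map of $(Q,+)$, i.e. $x+Ix=0$ for all $x\in Q$; $I\psi^3$ denotes the composition of maps (so $I\psi^3 x=-\psi^3x$). In the equation $\psi^5+\psi^4+1=0$, powers are under composition, sums are pointwise, $1$ is the identity automorphism and $0$ the zero endomorphism of $(Q,+)$; in $\psi^2 b+\psi b+b=0$ the symbol $0$ is the neutral element of $(Q,+)$. *)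

(* Defs.v *)
From mathcomp Require Import all_boot all_algebra.

Set Implicit Arguments.
Unset Strict Implicit.
Unset Printing Implicit Defensive.

Import GRing.Theory.
Local Open Scope ring_scope.

Definition quasigroup (T : Type) (op : T -> T -> T) : Prop :=
  forall a c : T, (exists! x, op a x = c) /\ (exists! y, op y a = c).

Definition Tquasigroup_op (Q : zmodType) (phi psi : Q -> Q) (b : Q)
    : Q -> Q -> Q :=
  fun x y => phi x + psi y + b.

Definition T2_identity (T : Type) (op : T -> T -> T) : Prop :=
  forall x y : T, op x (op y (op y x)) = y.

(* Automorphisms of (Q, +) are bijective additive maps; the lemma below shows
   that the operation they define is then always a quasigroup operation. *)
Lemma Tquasigroup_opP (Q : zmodType) (phi psi : {additive Q -> Q})
    (phi_bij : bijective phi) (psi_bij : bijective psi) (b : Q) :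
  quasigroup (Tquasigroup_op phi psi b).
Proof.
case: phi_bij => phi' phiK phi'K; case: psi_bij => psi' psiK psi'K a c.
rewrite /Tquasigroup_op; split.
- exists (psi' (c - b - phi a)); split=> [|x <-].
    by rewrite psi'K [phi a + _]addrC subrK subrK.
  by rewrite addrK [phi a + _]addrC addrK psiK.
- exists (phi' (c - b - psi a)); split=> [|y <-].
    by rewrite phi'K subrK subrK.
  by rewrite addrK addrK phiK.
Qed.

(* Main.v *)
Require Import Defs.
From mathcomp Require Import all_boot all_algebra.

Import GRing.Theory.
Local Open Scope ring_scope.

(** The word x(y(yx)) is an affine function of the pair (x, y), because phi and
    psi are additive ([T2_word_expand]).  It equals y everywhere exactly when
    its constant term vanishes, its x-coefficient phi + psi^3 is zero and its
    y-coefficient (psi^2 + psi) phi is the identity; the three conditions are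
    separated by evaluating at points with zero coordinates.  The first
    coefficient gives phi = - psi^3, which turns the y-coefficient into
    - (psi^5 + psi^4), so that the last requirement reads
    psi^5 + psi^4 + 1 = 0. *)

Lemma T2_word_expand (Q : zmodType) (phi psi : {additive Q -> Q}) (b x y : Q) :
  let op := Tquasigroup_op phi psi b in
  op x (op y (op y x)) =
    (phi x + iter 3 psi x) + (iter 2 psi (phi y) + psi (phi y))
    + (iter 2 psi b + psi b + b).
Proof.
rewrite /= /Tquasigroup_op !raddfD /= !addrA.
by rewrite [LHS](AC 7 (1*4*3*2*5*6*7))%AC.
Qed.

Theorem theorem2p3 (Q : zmodType) (phi psi : {additive Q -> Q})
    (phi_bij : bijective phi) (psi_bij : bijective psi) (b : Q) :
  T2_identity (Tquasigroup_op phi psi b) <->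
  [/\ phi =1 -%R \o iter 3 psi,
      iter 5 psi \+ iter 4 psi \+ id =1 \0
    & iter 2 psi b + psi b + b = 0].
Proof.
have psiN k z : iter k psi (- z) = - iter k psi z.
  by elim: k => //= k ->; rewrite raddfN.
have coefY y : phi y = - iter 3 psi y ->
    iter 2 psi (phi y) + psi (phi y) = - (iter 5 psi y + iter 4 psi y).
  by move=> ->; rewrite psiN /= raddfN opprD.
split=> [T2 | [phiE psiE b0] x y].
- have affine x y := esym (T2_word_expand Q phi psi b x y).
  have b0 : iter 2 psi b + psi b + b = 0.
    by have := affine 0 0; rewrite T2 /= !raddf0 !add0r.
  have phiE x : phi x = - iter 3 psi x.
    have := affine x 0; rewrite T2 b0 /= !raddf0 !addr0 => /eqP.
    by rewrite addr_eq0 => /eqP.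
  split=> // y /=.
  have := affine 0 y; rewrite T2 b0 (coefY _ (phiE y)) /= !raddf0 !add0r addr0.
  by move=> yE; rewrite -[X in _ + X]yE subrr.
- rewrite T2_word_expand b0 addr0 (coefY _ (phiE y)) phiE /= addNr add0r.
  by apply/eqP; rewrite eq_sym -addr_eq0 addrC; apply/eqP/psiE.
Qed.
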